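(* Let $S\subset\mathbb{R}^d$ be nonempty and closed. Suppose that the estimators $\hat f^n$ (random elements whose realizations are functions in $\mathrm{usc\text{-}fcns}(S)$) satisfy $\hat f^n\to f^0\in\mathrm{usc\text{-}fcns}(S)$ (in the metric $\mathbf{d}$) almost surely. If $\{\delta^n\geq0,n\in\mathbb{N}\}\to\delta$ and $\{\alpha^n\in[-\infty,\infty],n\in\mathbb{N}\}\to\alpha$, then the plug-in estimators $$\hat m^n\in\delta^n\text{-}\operatorname{argmax}_{x\in S}\hat f^n(x)\quad\text{and}\quad\hat l^n\in\operatorname{lev}_{\geq\alpha^n}\hat f^n$$ are consistent in the sense that almost surely $\delta\text{-}\operatorname{argmax}_{x\in S}f^0(x)$ and $\operatorname{lev}_{\geq\alpha}f^0$ contain every cluster point of $\{\hat m^n,n\in\mathbb{N}\}$ and $\{\hat l^n,n\in\mathbb{N}\}$, respectively. Moreover, if there is a compact $B\subset S$ such that for all $n$, $\operatorname{argmax}_{x\in S}\hat f^n(x)\cap B\neq\emptyset$ almost surely, then the plug-in estimator $$\hat h^n=\sup_{x\in S}\hat f^n(x)\to\sup_{x\in S}f^0(x)\quad\text{almost surely.}$$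
   Context: Notation: $\overline{\mathbb{R}}=[-\infty,\infty]$. $\mathrm{usc\text{-}fcns}(S)$ is the set of upper semicontinuous (usc) functions $f:S\to\overline{\mathbb{R}}$ with $f\not\equiv-\infty$. The hypograph is $\operatorname{hypo} f=\{(x,\alpha)\in S\times\mathbb{R}\mid f(x)\geq\alpha\}$. Fix any norm on $\mathbb{R}^d\times\mathbb{R}$ and a point $z^{\rm ctr}\in S\times\mathbb{R}$. The Attouch-Wets (aw) distance is $\mathbf{d}(f,g)=\int_0^\infty \mathbf{d}_\rho(f,g)e^{-\rho}d\rho$, where $\mathbf{d}_\rho(f,g)=\max\{|\operatorname{dist}(z,\operatorname{hypo} f)-\operatorname{dist}(z,\operatorname{hypo} g)| : \|z-z^{\rm ctr}\|\leq\rho\}$ and $\operatorname{dist}$ is the point-to-set distance. Convergence $\mathbf{d}(f^n,f)\to0$ is equivalent to hypo-convergence: $\limsup f^n(x^n)\leq f(x)$ for all $x^n\in S\to x$, and for every $x\in S$ there is $x^n\in S\to x$ with $\liminf f^n(x^n)\geq f(x)$. For $\epsilon\in[0,\infty)$ and $f:S\to\overline{\mathbb{R}}$, $\epsilon\text{-}\operatorname{argmax}_{x\in S}f(x)=\{y\in S\mid f(y)\geq\sup_{x\in S}f(x)-\epsilon\}$ (with $\infty-\epsilon=\infty$), and $\operatorname{argmax}$ is the case $\epsilon=0$. $\operatorname{lev}_{\geq\alpha}f=\{x\in S\mid f(x)\geq\alpha\}$. *)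

(* Defs.v *)
From HB Require Import structures.
From mathcomp Require Export all_boot all_order all_algebra.
From mathcomp Require Export all_classical all_reals all_analysis.

Set Implicit Arguments.
Unset Strict Implicit.
Unset Printing Implicit Defensive.

Import Order.TTheory GRing.Theory Num.Theory.
Import numFieldNormedType.Exports.

Local Open Scope classical_set_scope.
Local Open Scope ring_scope.
Local Open Scope ereal_scope.

(* Mirror image of the library's [lower_semicontinuous]. *)
Definition upper_semicontinuous (R : realType) (X : topologicalType)
    (f : X -> \bar R) :=
  forall x a, f x < a%:E -> exists2 V, nbhs x V & forall y, V y -> f y < a%:E.

Record usc_fcns (R : realType) (d : nat) (S : set 'rV[R]_d) := UscFcns {
  usc_val :> S -> \bar R ;
  usc_valP : upper_semicontinuous usc_val ;
  usc_proper : exists x, usc_val x != -oo }.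

Definition hypo (R : realType) (d : nat) (S : set 'rV[R]_d)
    (f : S -> \bar R) : set ('rV[R]_d * R) :=
  [set z | exists2 x : S, set_val x = z.1 & z.2%:E <= f x].

Definition is_norm (R : realType) (V : lmodType R) (N : V -> R) : Prop :=
  [/\ forall x y, (N (x + y)%R <= N x + N y)%R,
      forall a x, N (a *: x)%R = (`|a| * N x)%R
    & forall x, N x = 0%R -> x = 0%R].

Definition dist_to (R : realType) (V : zmodType) (N : V -> R) (z : V)
    (A : set V) : R :=
  inf [set N (z - w)%R | w in A].

(* The supremum below is over a nonempty compact ball of a continuous function,
   hence it is a maximum. *)
Definition aw_dist_rho (R : realType) (d : nat) (S : set 'rV[R]_d)
    (N : 'rV[R]_d * R -> R) (zctr : 'rV[R]_d * R) (f g : S -> \bar R)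
    (rho : R) : R :=
  sup [set `|dist_to N z (hypo f) - dist_to N z (hypo g)|%R
      | z in [set z | (N (z - zctr) <= rho)%R]].

Definition aw_dist (R : realType) (d : nat) (S : set 'rV[R]_d)
    (N : 'rV[R]_d * R -> R) (zctr : 'rV[R]_d * R) (f g : S -> \bar R)
    : \bar R :=
  \int[lebesgue_measure]_(rho in `[0%R, +oo[)
    (aw_dist_rho N zctr f g rho * expR (- rho))%:E.

Definition aw_open (R : realType) (d : nat) (S : set 'rV[R]_d)
    (N : 'rV[R]_d * R -> R) (zctr : 'rV[R]_d * R) : set (set (usc_fcns S)) :=
  [set U | forall f : usc_fcns S, U f -> exists2 e : R, (0 < e)%R &
     forall g : usc_fcns S, aw_dist N zctr f g < e%:E -> U g].

(* Measurability with respect to the Borel sigma-algebra of the aw-distance. *)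
Definition random_usc_fcn (R : realType) (d : nat) (S : set 'rV[R]_d)
    (N : 'rV[R]_d * R -> R) (zctr : 'rV[R]_d * R)
    (disp : measure_display) (T : measurableType disp)
    (F : T -> usc_fcns S) : Prop :=
  forall A, <<s @aw_open R d S N zctr >> A -> measurable (F @^-1` A).

Definition supS (R : realType) (d : nat) (S : set 'rV[R]_d)
    (f : S -> \bar R) : \bar R :=
  ereal_sup (range f).

(* In [\bar R], [+oo - eps%:E = +oo]. *)
Definition eps_argmax (R : realType) (d : nat) (S : set 'rV[R]_d) (eps : R)
    (f : S -> \bar R) : set 'rV[R]_d :=
  [set set_val y | y in [set y : S | supS f - eps%:E <= f y]].

Definition argmax (R : realType) (d : nat) (S : set 'rV[R]_d)
    (f : S -> \bar R) : set 'rV[R]_d :=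
  eps_argmax 0%R f.

Definition lev_ge (R : realType) (d : nat) (S : set 'rV[R]_d) (a : \bar R)
    (f : S -> \bar R) : set 'rV[R]_d :=
  [set set_val x | x in [set x : S | a <= f x]].

Definition cluster_points (R : realType) (d : nat) (u : nat -> 'rV[R]_d)
    : set 'rV[R]_d :=
  cluster (u @ \oo).

(* Main.v *)
(* For z in the ball of radius rho around zctr, the difference of the distances
   from z to the two hypographs is at most d_rho, and since d_rho increases with
   rho, d_rho e^-(rho+1) <= d. Convergence in d therefore gives pointwise
   convergence of z |-> dist(z, hypo f^n). As all norms are equivalent and the
   hypograph of the usc limit is closed, this yields: any real a with
   f^n(y^n) >= a frequently as y^n clusters at x satisfies f^0(x) >= a, and
   liminf sup f^n >= sup f^0. *)

Require Import Defs.
From mathcomp Require Import lra measurable_realfun.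
Import Order.TTheory GRing.Theory Num.Theory.
Import numFieldNormedType.Exports.
Local Open Scope classical_set_scope.
Local Open Scope ring_scope.

(** * Distance to a set for an arbitrary norm *)

Section IsNorm.
Context {R : realType} {V : lmodType R} {N : V -> R}.
Hypothesis N_norm : is_norm N.

Lemma is_norm0 : N 0 = 0.
Proof.
by case: N_norm => _ NZ _; rewrite -(scale0r (0 : V)) NZ normr0 mul0r.
Qed.

Lemma is_normN x : N (- x) = N x.
Proof. by case: N_norm => _ NZ _; rewrite -scaleN1r NZ normrN1 mul1r. Qed.

Lemma is_norm_triangle x y : N (x + y) <= N x + N y.
Proof. by case: N_norm => + _ _; exact. Qed.

Lemma is_normB x y : N (x - y) = N (y - x).
Proof. by rewrite -is_normN opprB. Qed.

Lemma is_norm_ge0 x : 0 <= N x.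
Proof.
have := is_norm_triangle x (- x); rewrite subrr is_norm0 is_normN; lra.
Qed.

Lemma is_norm_sum n (u : 'I_n -> V) : N (\sum_i u i) <= \sum_i N (u i).
Proof.
apply: (big_ind2 (fun a b => N a <= b)) => // [|x a y b xa yb].
  by rewrite is_norm0.
exact: le_trans (is_norm_triangle _ _) (lerD xa yb).
Qed.

Lemma dist_to_le z w A : A w -> dist_to N z A <= N (z - w).
Proof.
move=> Aw; apply: ge_inf; last by exists w.
by exists 0 => _ [v _ <-]; exact: is_norm_ge0.
Qed.

Lemma dist_to_ge0 z A : 0 <= dist_to N z A.
Proof.
have [->|/set0P[a Aa]] := eqVneq A set0.
  by rewrite /dist_to image_set0 inf0.
apply: lb_le_inf; first by exists (N (z - a)), a.
by move=> _ [v _ <-]; exact: is_norm_ge0.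
Qed.

(** The infimum need not be attained, so a point is extracted only below a strict bound.
    Nonemptiness excludes the default value 0 of [inf] on the empty set. *)
Lemma dist_to_lt z A e : A !=set0 -> dist_to N z A < e ->
  exists2 w, A w & N (z - w) < e.
Proof.
move=> [a Aa] dze.
have e0 : 0 < e - dist_to N z A by rewrite subr_gt0.
have [|_ [w Aw <-] we] := @inf_adherent _ [set N (z - w) | w in A] _ e0; last first.
  exists w => //; apply: lt_le_trans we _.
  by rewrite -/(dist_to N z A) addrC subrK.
split; first by exists (N (z - a)), a.
by exists 0 => _ [v _ <-]; exact: is_norm_ge0.
Qed.

Lemma dist_to_triangle z z' A :
  A !=set0 -> dist_to N z A <= dist_to N z' A + N (z - z').
Proof.
move=> A0; apply/ler_addgt0Pr => e e0.
have [|w Aw ze] := @dist_to_lt z' A (dist_to N z' A + e) A0.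
  by rewrite ltrDl.
apply: le_trans (dist_to_le _ _ _ Aw) _.
have := is_norm_triangle (z - z') (z' - w); rewrite subrKA; lra.
Qed.

End IsNorm.

(** * Equivalence of [N] with the max norm *)

Lemma row_coord_le_norm {R : realType} {d : nat} (x : 'rV[R]_d) j :
  `|x 0 j| <= `|x|.
Proof. by rewrite [leRHS]mx_normrE (le_bigmax _ _ (0, j)). Qed.

Section NormEquivalence.
Context {R : realType} {d : nat} {N : 'rV[R]_d * R -> R}.
Hypothesis N_norm : is_norm N.

(** Expand in the standard basis, whose [N]-norms are summed; every coordinate is bounded by the max
    norm. Adding 1 makes the constant positive at once. *)
Lemma is_norm_le_norm : exists2 C, 0 < C & forall z, N z <= C * `|z|.
Proof.
pose C := \sum_j N ('e_j : 'rV[R]_d, 0) + N (0, 1).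
have C0 : 0 <= C.
  by rewrite addr_ge0 ?sumr_ge0// => *; exact: is_norm_ge0.
exists (C + 1) => [|[x a]]; first lra.
have xaE : (x, a) =
    \sum_j x 0 j *: ('e_j : 'rV[R]_d, 0 : R) + a *: (0, 1).
  apply/pair_equal_spec; split; rewrite /= raddf_sum/=.
    by rewrite scaler0 addr0 {1}(row_sum_delta x).
  rewrite big1 ?add0r /= => [|*]; first by rewrite /GRing.scale/= mulr1.
  by rewrite /GRing.scale/= mulr0.
rewrite {1}xaE; apply: le_trans (is_norm_triangle N_norm _ _) _.
apply: le_trans (lerD (is_norm_sum N_norm _ _) (lexx _)) _.
have [_ NZ _] := N_norm; rewrite NZ.
under eq_bigr do rewrite NZ.
apply: (@le_trans _ _ (C * `|(x, a)|)); last first.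
  by rewrite ler_wpM2r// lerDl.
rewrite mulrDl mulr_suml prod_normE lerD//.
  apply: ler_sum => j _; rewrite mulrC ler_wpM2l ?is_norm_ge0//.
  by rewrite le_max row_coord_le_norm.
by rewrite mulrC ler_wpM2l ?is_norm_ge0// le_max lexx orbT.
Qed.

Lemma is_norm_continuous : continuous N.
Proof.
have [C C0 NC] := is_norm_le_norm.
move=> z; apply/cvgrPdist_lt => e e0.
near=> w.
have zw : C * `|z - w| < e.
  rewrite mulrC -ltr_pdivlMr//; near: w.
  by apply: cvgr_dist_lt; rewrite ?divr_gt0.
apply: le_lt_trans zw; apply: le_trans (NC _).
have := is_norm_triangle N_norm (z - w) w.
have := is_norm_triangle N_norm (w - z) z.
rewrite !subrK (is_normB N_norm w z) => h1 h2.
rewrite ler_norml; lra.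
Unshelve. all: by end_near. Qed.

Lemma norm_sphere_compact : compact [set z : 'rV[R]_d * R | `|z| = 1].
Proof.
apply: (@subclosed_compact _ _
    ([set x : 'rV[R]_d | `|x| <= 1] `*` [set a : R | `|a| <= 1])).
- apply: (@closed_comp _ _ (fun z : 'rV[R]_d * R => `|z|) [set 1]).
    by move=> *; exact: norm_continuous.
  exact: closed_eq.
- apply: compact_setX.
    apply: bounded_closed_compact.
      by exists 1; split=> // M M1 x /= /le_trans; apply; exact: ltW.
    apply: (@closed_comp _ _ (fun z : 'rV[R]_d => `|z|) [set y | y <= 1]).
      by move=> *; exact: norm_continuous.
    exact: closed_le.
  rewrite (_ : mkset _ = `[-1, 1]%classic); first exact: segment_compact.
  by apply/seteqP; split=> a /=; rewrite in_itv/= ler_norml.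
- move=> z /=; rewrite prod_normE => <-.
  by split; rewrite /= le_max lexx ?orbT.
Qed.

(** The image of the unit sphere under [N] is compact, hence closed, and misses 0 by definiteness.
    The radius [c] of a ball around 0 avoiding it bounds [N] below on the sphere; homogeneity does
    the rest. *)
Lemma norm_le_is_norm : exists2 c, 0 < c & forall z, c * `|z| <= N z.
Proof.
have clN : closed (N @` [set z | `|z| = 1]).
  apply: compact_closed; first exact: Rhausdorff.
  apply: continuous_compact norm_sphere_compact.
  by apply: continuous_subspaceT; exact: is_norm_continuous.
have [_ NZ N_eq0] := N_norm.
have : nbhs 0 (~` (N @` [set z | `|z| = 1])).
  apply: open_nbhs_nbhs; split; first exact: closed_openC.
  by move=> [z /= z1 /N_eq0 z0]; move: z1; rewrite z0 normr0; lra.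
move=> /nbhs_ballP[c /= c0 cN]; exists c => // z.
have [->|z0] := eqVneq z 0; first by rewrite normr0 mulr0 is_norm_ge0.
have nz : 0 < `|z| by rewrite normr_gt0.
rewrite -ler_pdivlMr// leNgt; apply/negP => ltc.
have := cN (N (`|z|^-1 *: z)); apply.
  rewrite /ball/= sub0r normrN ger0_norm ?is_norm_ge0// NZ.
  by rewrite ger0_norm ?invr_ge0// mulrC.
by exists (`|z|^-1 *: z) => //=; rewrite normrZ normfV normr_id mulVf ?gt_eqF.
Qed.

End NormEquivalence.

(** * From the Attouch-Wets distance to distances from hypographs *)

Section AttouchWets.
Context {R : realType} {d : nat} {S : set 'rV[R]_d}.
Context {N : 'rV[R]_d * R -> R} (zctr : 'rV[R]_d * R).
Hypothesis N_norm : is_norm N.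

Lemma hypo_neq0 (f : usc_fcns S) : hypo f !=set0.
Proof.
have [x] := usc_proper f; case fx: (usc_val f x) => [r| |] // _.
  by exists (set_val x, r), x => //=; rewrite fx.
by exists (set_val x, 0), x => //=; rewrite fx leey.
Qed.

Implicit Types f g : usc_fcns S.

(** Both distances are 1-Lipschitz for [N], so their difference moves by at most [2 * rho] from its
    value at [zctr]. This keeps the [sup] in [aw_dist_rho] from taking its default value on
    unbounded sets. *)
Lemma hypo_dist_diff_ub f g rho :
  has_ubound [set `|dist_to N z (hypo f) - dist_to N z (hypo g)|
             | z in [set z | N (z - zctr) <= rho]].
Proof.
exists (`|dist_to N zctr (hypo f) - dist_to N zctr (hypo g)| + 2 * rho).
move=> _ [z /= zrho <-].
have f1 := dist_to_triangle N_norm z zctr _ (hypo_neq0 f).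
have f2 := dist_to_triangle N_norm zctr z _ (hypo_neq0 f).
have g1 := dist_to_triangle N_norm z zctr _ (hypo_neq0 g).
have g2 := dist_to_triangle N_norm zctr z _ (hypo_neq0 g).
move: f2 g2; rewrite (is_normB N_norm zctr z) => f2 g2.
have := ler_norm (dist_to N zctr (hypo f) - dist_to N zctr (hypo g)).
have := lerNnormlW (lexx `|dist_to N zctr (hypo f) - dist_to N zctr (hypo g)|).
rewrite ler_norml => h1 h2; apply/andP; split; lra.
Qed.

Lemma le_aw_dist_rho f g z rho : N (z - zctr) <= rho ->
  `|dist_to N z (hypo f) - dist_to N z (hypo g)| <= aw_dist_rho N zctr f g rho.
Proof.
by move=> zrho; apply: ub_le_sup; [exact: hypo_dist_diff_ub | exists z].
Qed.

Lemma aw_dist_rho_ge0 f g rho : 0 <= aw_dist_rho N zctr f g rho.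
Proof.
rewrite /aw_dist_rho.
(* A negative [rho] gives an empty ball, where [sup] is 0 by default. *)
set A := [set _ | _ in _]; have [->|/set0P[a Aa]] := eqVneq A set0.
  by rewrite sup0.
apply: le_trans (ub_le_sup (hypo_dist_diff_ub f g rho) Aa).
by case: Aa => z _ <-.
Qed.

Lemma aw_dist_rho_nondecreasing f g :
  {homo aw_dist_rho N zctr f g : r s / r <= s}.
Proof.
move=> r s rs; rewrite {1}/aw_dist_rho.
set A := [set _ | _ in _]; have [->|A0] := eqVneq A set0.
  by rewrite sup0 aw_dist_rho_ge0.
apply: ge_sup; first exact/set0P.
move=> _ [z /= zr <-]; apply: le_aw_dist_rho; exact: le_trans rs.
Qed.

(** Restrict the nonnegative integrand to [[rho, rho + 1]], of measure 1: there the first factor is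
    at least its value at the left end, the exponential at least its value at the right end. *)
Lemma aw_dist_rho_le_aw_dist f g rho : 0 <= rho ->
  ((aw_dist_rho N zctr f g rho * expR (- (rho + 1)))%:E <= aw_dist N zctr f g)%E.
Proof.
move=> rho0; set F := aw_dist_rho N zctr f g.
(* Monotonicity in the radius makes [F] measurable. *)
have mF (D : set R) : measurable D ->
    measurable_fun D (EFin \o (fun x => F x * expR (- x))).
  move=> mD; apply/measurable_EFinP; apply: measurable_funM.
    exact: nondecreasing_measurable (aw_dist_rho_nondecreasing f g).
  by apply: measurableT_comp => //; apply: measurableT_comp.
have F0 x : 0 <= F x * expR (- x).
  by rewrite mulr_ge0 ?aw_dist_rho_ge0 ?expR_ge0.
apply: (@le_trans _ _
    (\int[lebesgue_measure]_(x in `[rho, (rho + 1)%R]) (F x * expR (- x))%:E)%E).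
  rewrite -[leLHS]mule1 -[X in (_ * X)%E](_ : lebesgue_measure `[rho, (rho + 1)%R]%classic = _); last first.
    rewrite lebesgue_measure_itv/= lte_fin ltrDl ltr01 -EFinB.
    by rewrite addrAC subrr add0r.
  rewrite -integral_cst//; apply: ge0_le_integral => //.
  - by move=> x _; rewrite lee_fin mulr_ge0 ?aw_dist_rho_ge0 ?expR_ge0.
  - exact: mF.
  - move=> x /=; rewrite in_itv/= => /andP[rx xr].
    rewrite lee_fin ler_pM ?aw_dist_rho_ge0 ?expR_ge0//.
      exact: aw_dist_rho_nondecreasing.
    by rewrite ler_expR lerN2.
apply: ge0_subset_integral => //; first exact: mF.
- by move=> x _; rewrite lee_fin.
- by move=> x /=; rewrite !in_itv/= andbT => /andP[/(le_trans rho0)].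
Qed.

Lemma aw_cvg_dist_to (f : nat -> usc_fcns S) g :
  aw_dist N zctr (f n) g @[n --> \oo] --> 0%E ->
  forall z, dist_to N z (hypo (f n)) @[n --> \oo] --> dist_to N z (hypo g).
Proof.
move=> fg z; apply/cvgrPdist_lt => e e0.
(* This is the smallest radius whose ball contains [z]. The exponential in the threshold below
   cancels the one in [aw_dist_rho_le_aw_dist]. *)
pose rho := N (z - zctr).
have /fg : nbhs 0%E [set x | (x < (e * expR (- (rho + 1)))%:E)%E].
  apply: open_nbhs_nbhs; split; first exact: open_ereal_lt_ereal.
  by rewrite /= lte_fin mulr_gt0 ?expR_gt0.
move=> fgn; near=> n.
have lt_aw : (aw_dist N zctr (f n) g < (e * expR (- (rho + 1)))%:E)%E.
  by near: n; exact: fgn.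
have := aw_dist_rho_le_aw_dist (f n) g rho (is_norm_ge0 N_norm _).
move=> /le_lt_trans/(_ lt_aw); rewrite lte_fin ltr_pM2r ?expR_gt0//.
by rewrite distrC; apply: le_lt_trans; exact: le_aw_dist_rho.
Unshelve. all: by end_near. Qed.

End AttouchWets.

(** * Extended reals tested against real bounds *)

Lemma lte_fin_between {R : realType} (x y : \bar R) :
  (x < y)%E -> exists r : R, (x < r%:E < y)%E.
Proof.
case: x y => [x| |] [y| |]//= xy.
- exists ((x + y) / 2); move: xy; rewrite !lte_fin => xy.
  by apply/andP; split; lra.
- by exists (x + 1); rewrite lte_fin ltrDl ltr01 ltey.
- by exists (y - 1); rewrite ltNye lte_fin ltrBlDr ltrDl ltr01.
- by exists 0; rewrite ltNye ltey.
Qed.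

Lemma lee_fin_lower {R : realType} (x y : \bar R) :
  (forall r : R, (r%:E < x)%E -> (r%:E <= y)%E) -> (x <= y)%E.
Proof.
move=> xy; rewrite leNgt; apply/negP => /lte_fin_between[r /andP[yr rx]].
by have := xy _ rx; rewrite leNgt yr.
Qed.

(** Finite and infinite limits are treated alike: at an infinite [l] one of the two premises is
    vacuous. *)
Lemma cvge_fin_between {R : realType} (u : nat -> \bar R) (l : \bar R) :
  (forall r : R, (r%:E < l)%E -> \forall n \near \oo, (r%:E < u n)%E) ->
  (forall r : R, (l < r%:E)%E -> \forall n \near \oo, (u n < r%:E)%E) ->
  u n @[n --> \oo] --> l.
Proof.
move=> lo up A; case: l lo up => [l| |] lo up /=.
- move=> lA; have /nbhs_ballP[e /= e0 eA] : nbhs l (fun r => A r%:E) := lA.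
  have le : ((l - e)%:E < l%:E)%E by rewrite lte_fin ltrBlDr ltrDl.
  have el : (l%:E < (l + e)%:E)%E by rewrite lte_fin ltrDl.
  change (\forall n \near \oo, A (u n)); near=> n.
  have : ((l - e)%:E < u n)%E by near: n; exact: lo.
  have : (u n < (l + e)%:E)%E by near: n; exact: up.
  case un : (u n) => [s| |]//; rewrite !lte_fin => h1 h2.
  apply: eA.
  by rewrite /ball/= distrC ltr_norml; apply/andP; split; lra.
- move=> [M [_ MA]]; change (\forall n \near \oo, A (u n)); near=> n; apply: MA.
  by near: n; apply: lo; rewrite ltey.
- move=> [M [_ MA]]; change (\forall n \near \oo, A (u n)); near=> n; apply: MA.
  by near: n; apply: up; rewrite ltNye.
Unshelve. all: by end_near. Qed.

(** * Limits of level sets, near-maximizers and suprema *)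

Section HypoLimit.
Context {R : realType} {d : nat} {S : set 'rV[R]_d}.
Context {N : 'rV[R]_d * R -> R}.
Hypothesis N_norm : is_norm N.

Lemma lev_ge_set_val (a : \bar R) (f : S -> \bar R) (x : S) :
  lev_ge a f (set_val x) <-> (a <= f x)%E.
Proof.
split=> [[y /= ay /val_inj <-]//|ax]; by exists x.
Qed.

(** This is closedness of the hypograph within [S]: if [g x < b < a], then [g] stays below [b] near
    [x], while a hypograph point close to [(x, a)] has height above [b]. *)
Lemma dist_to_hypo_eq0 (g : usc_fcns S) (x : S) (a : R) :
  dist_to N (set_val x, a) (hypo g) = 0 -> (a%:E <= g x)%E.
Proof.
move=> dist0; rewrite leNgt; apply/negP => /lte_fin_between[b /andP[gb ba]].
move: ba; rewrite lte_fin => ba.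
(* Neighbourhoods in [S] are traces of ambient ones: [W] is open in the space of rows. *)
have [V [_ [[W oW <-]] /= Wx WV gV]] := usc_valP gb.
have /nbhs_ballP[e /= e0 eW] : nbhs (set_val x) W by exact: open_nbhs_nbhs.
have [c c0 cN] := norm_le_is_norm N_norm.
(* The bound [e] keeps the base point in [W], the bound [a - b] keeps the height above [b]. *)
pose e' := Num.min e (a - b).
have e'0 : 0 < e' by rewrite lt_min e0 subr_gt0.
have [|w [y yw wy] Nw] :=
  dist_to_lt N_norm (set_val x, a) _ (c * e') (hypo_neq0 g).
  by rewrite dist0 mulr_gt0.
have : `|(set_val x, a) - w| < e'.
  by rewrite -(ltr_pM2l c0); exact: le_lt_trans (cN _) Nw.
rewrite prod_normE gt_max /= => /andP[xw aw].
have Vy : W (set_val y).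
  rewrite yw; apply: eW; rewrite -ball_normE /ball_/=.
  by apply: lt_le_trans xw _; rewrite ge_min lexx.
have := gV _ (WV _ Vy).
rewrite ltNge => /negP; apply; apply: le_trans wy; rewrite lee_fin.
have : `|a - w.2| < a - b by apply: lt_le_trans aw _; rewrite ge_min lexx orbT.
by rewrite ltr_norml; lra.
Qed.

Variables (f : nat -> usc_fcns S) (g : usc_fcns S).
Hypothesis fg : forall z,
  dist_to N z (hypo (f n)) @[n --> \oo] --> dist_to N z (hypo g).

(* [F] stands for a subsequence. *)
Lemma hypo_cvg_cluster (F : set_system nat) (y : nat -> 'rV[R]_d) (x : S)
    (a : R) : ProperFilter F -> F --> \oo ->
  (\forall n \near F, lev_ge a%:E (f n) (y n)) ->
  cluster (y @ F) (set_val x) -> (a%:E <= g x)%E.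
Proof.
move=> PF Foo Fy clx; apply: dist_to_hypo_eq0.
apply/eqP; rewrite eq_le dist_to_ge0// andbT.
apply/ler_addgt0Pr => e e0; rewrite add0r.
have [C C0 NC] := is_norm_le_norm N_norm.
have e20 : 0 < e / 2 by rewrite divr_gt0.
have /cvgrPdist_lt/(_ _ e20)/Foo Fdist := fg (set_val x, a).
pose Q := [set n | lev_ge a%:E (f n) (y n) /\
  `|dist_to N (set_val x, a) (hypo g) -
    dist_to N (set_val x, a) (hypo (f n))| < e / 2].
have FQ : F Q by exact: filterI.
have yFQ : (y @ F) (y @` Q).
  by apply: (filterS _ FQ : F (y @^-1` (y @` Q))) => n Qn; exists n.
have [|_ [[n [[v /= av vy] dn] <-]]] :=
  clx (y @` Q) (ball (set_val x) (e / 2 / C)) yFQ.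
  by apply: nbhsx_ballx; rewrite divr_gt0.
rewrite -ball_normE /ball_/= => xy.
have : dist_to N (set_val x, a) (hypo (f n)) <= e / 2.
  (* The competitor has the same height [a], so only the gap between base points counts. *)
  apply: le_trans (dist_to_le N_norm _ (y n, a) _ _) _; first by exists v.
  apply: le_trans (NC _) _; rewrite mulrC -ler_pdivlMr//.
  rewrite prod_normE /= subrr normr0 ge_max (ltW xy)/=.
  by rewrite !divr_ge0// ltW.
by move: dn; rewrite ltr_norml; lra.
Qed.

(** A point [(x, b)] of [hypo g] with [a < b] is eventually close to [hypo (f n)], which therefore
    has a point of height above [a]. *)
Lemma hypo_cvg_lt_supS (a : R) : (a%:E < supS g)%E ->
  \forall n \near \oo, (a%:E < supS (f n))%E.
Proof.
move=> /ereal_sup_gt[_ [x _ <-]] /lte_fin_between[b /andP[ab bg]].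
move: ab; rewrite lte_fin => ab.
have [c c0 cN] := norm_le_is_norm N_norm.
have cab : 0 < c * (b - a) by rewrite mulr_gt0// subr_gt0.
have dist0 : dist_to N (set_val x, b) (hypo g) = 0.
  apply/eqP; rewrite eq_le dist_to_ge0// andbT.
  have := dist_to_le N_norm (set_val x, b) (set_val x, b) (hypo g).
  by rewrite subrr is_norm0//; apply; exists x => //=; exact: ltW.
have /cvgrPdist_lt/(_ _ cab) := fg (set_val x, b).
apply: filterS => n; rewrite dist0 sub0r normrN ger0_norm ?dist_to_ge0//.
move=> /(dist_to_lt N_norm _ _ _ (hypo_neq0 (f n)))[w [y yw wy] Nw].
have : `|(set_val x, b) - w| < b - a.
  by rewrite -(ltr_pM2l c0); exact: le_lt_trans (cN _) Nw.
rewrite prod_normE gt_max /= => /andP[_]; rewrite ltr_norml => bw.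
apply: (@lt_le_trans _ _ w.2%:E); first by rewrite lte_fin; lra.
by apply: le_trans wy _; apply: ereal_sup_ubound; exists y.
Qed.

Lemma cluster_closed_mem (u : nat -> 'rV[R]_d) : closed S ->
  (forall n, S (u n)) -> cluster_points u `<=` S.
Proof.
move=> cS Su x clx; apply: cS => B Bx.
have [|y [[n _ <-] By]] := clx (range u) B _ Bx.
  by exists 0 => // n _; exists n.
by exists (u n).
Qed.

Lemma lev_ge_sub a (h : S -> \bar R) : lev_ge a h `<=` S.
Proof. by move=> _ [x _ <-]; exact: set_valP. Qed.

Lemma set_val_surj x : S x -> exists x' : S, set_val x' = x.
Proof. by move=> /mem_set Sx; exists (exist _ x Sx). Qed.

(** The premise on the levels is one-sided so that it also covers near-maximizers, whose levels
    [supS (f n) - (del n)%:E] are controlled only from below. *)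
Lemma hypo_cvg_lev_ge (a : nat -> \bar R) (b : \bar R) (u : nat -> 'rV[R]_d) :
  closed S ->
  (forall r : R, (r%:E < b)%E -> \forall n \near \oo, (r%:E <= a n)%E) ->
  (forall n, lev_ge (a n) (f n) (u n)) ->
  cluster_points u `<=` lev_ge b g.
Proof.
move=> cS ab au x clx.
have /set_val_surj[x' xx'] : S x.
  by apply: cluster_closed_mem clx => // n; apply: lev_ge_sub (au n).
move: clx; rewrite -xx' => clx.
apply/lev_ge_set_val/lee_fin_lower => r /ab ra.
apply: (@hypo_cvg_cluster \oo u) clx => //.
apply: filterS ra => n ra.
by have [y /= ay yu] := au n; exists y => //=; exact: le_trans ay.
Qed.

Lemma hypo_cvg_eps_argmax (del : nat -> R) (e : R) (u : nat -> 'rV[R]_d) :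
  closed S -> del n @[n --> \oo] --> e ->
  (forall n, eps_argmax (del n) (f n) (u n)) ->
  cluster_points u `<=` eps_argmax e g.
Proof.
move=> cS dele; apply: hypo_cvg_lev_ge => // r.
(* The margin between [r + e] and [s] absorbs the error of [del n]. *)
rewrite lteBrDr// -EFinD => /lte_fin_between[s /andP[]].
rewrite lte_fin => res sg; near=> n.
have : (s%:E < supS (f n))%E by near: n; exact: hypo_cvg_lt_supS.
have : `|e - del n| < s - (r + e).
  by near: n; apply: cvgr_dist_lt => //; rewrite subr_gt0.
rewrite ltr_norml => h1 h2.
rewrite leeBrDr// -EFinD; apply: le_trans (ltW h2).
by rewrite lee_fin; lra.
Unshelve. all: by end_near. Qed.

(** For the upper bound, if [supS (f n)] reached some [r] above [supS g] infinitely often, the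
    maximizers for those [n] would cluster in [B] at a point where [g] is at least [r]. *)
Lemma hypo_cvg_supS (B : set 'rV[R]_d) : compact B -> B `<=` S ->
  (forall n, argmax (f n) `&` B !=set0) ->
  supS (f n) @[n --> \oo] --> supS g.
Proof.
move=> cB BS fB; apply: cvge_fin_between => r gr.
  exact: hypo_cvg_lt_supS.
have [y yB] := choice fB.
apply: contrapT => nup.
(* This filter replaces a subsequence; it is proper because the indices it retains are not
   eventually excluded. *)
pose G := within [set n | (r%:E <= supS (f n))%E] \oo.
have PG : ProperFilter G.
  apply: Build_ProperFilter_ex => A GA; apply: contrapT => A0; apply: nup.
  have : \forall n \near \oo, (r%:E <= supS (f n))%E -> A n by exact: GA.
  apply: filterS => n An; rewrite ltNge; apply/negP => /An Ann.
  by apply: A0; exists n.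
have [|x [Bx clx]] := cB (y @ G) _.
  by exists 0 => // n _ _; have [] := yB n.
have [x' xx'] := set_val_surj _ (BS _ Bx).
have : (r%:E <= g x')%E.
  apply: (@hypo_cvg_cluster G y).
  - exact: cvg_within.
  - apply: (nearW (F := \oo)) => n /= rf; have [[z /= + zy] _] := yB n.
    by rewrite sube0 => fz; exists z => //=; exact: le_trans fz.
  - by rewrite xx'.
rewrite leNgt => /negP; apply; apply: le_lt_trans gr.
by apply: ereal_sup_ubound; exists x'.
Qed.

End HypoLimit.

Theorem theorem3p16 (R : realType) (d : nat) (S : set 'rV[R]_d)
  (S_neq0 : S !=set0) (S_closed : closed S)
  (N : 'rV[R]_d * R -> R) (N_norm : is_norm N)
  (zctr : 'rV[R]_d * R) (zctr_in : S zctr.1)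
  (disp : measure_display) (T : measurableType disp) (P : probability T R)
  (fhat : nat -> T -> usc_fcns S)
  (fhat_random : forall n, random_usc_fcn N zctr (fhat n))
  (f0 : usc_fcns S)
  (fhat_cvg : {ae P, forall w,
     aw_dist N zctr (fhat n w) f0 @[n --> \oo] --> 0%E}) :
  [/\ forall (deltan : nat -> R) (delta : R) (mhat : nat -> T -> 'rV[R]_d),
        (forall n, 0 <= deltan n) ->
        deltan n @[n --> \oo] --> delta ->
        (forall n, {ae P, forall w,
           eps_argmax (deltan n) (fhat n w) (mhat n w)}) ->
        {ae P, forall w,
           cluster_points (fun n => mhat n w) `<=` eps_argmax delta f0},
      forall (alphan : nat -> \bar R) (alpha : \bar R)
             (lhat : nat -> T -> 'rV[R]_d),
        alphan n @[n --> \oo] --> alpha ->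
        (forall n, {ae P, forall w,
           lev_ge (alphan n) (fhat n w) (lhat n w)}) ->
        {ae P, forall w,
           cluster_points (fun n => lhat n w) `<=` lev_ge alpha f0}
    & forall B : set 'rV[R]_d,
        compact B -> B `<=` S ->
        (forall n, {ae P, forall w, argmax (fhat n w) `&` B !=set0}) ->
        {ae P, forall w,
           supS (fhat n w) @[n --> \oo] --> supS f0}].

Proof.
have cvg_dist : {ae P, forall w z,
    dist_to N z (hypo (fhat n w)) @[n --> \oo] --> dist_to N z (hypo f0)}.
  by apply: filterS fhat_cvg => w; exact: aw_cvg_dist_to.
(* Countably many almost sure statements hold on one common event, so each claim becomes
   deterministic for a fixed [w]. *)
split=> [deltan delta mhat _ cdelta /ae_foralln|alphan alpha lhat calpha
    /ae_foralln|B cB BS /ae_foralln]; apply: filterS2 cvg_dist => w fw aw.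
- exact: (hypo_cvg_eps_argmax N_norm (fhat^~ w) f0 fw _ _ _ S_closed cdelta aw).
- apply: (hypo_cvg_lev_ge N_norm (fhat^~ w) f0 fw _ _ _ S_closed _ aw) => r ralpha.
  apply: (calpha [set a | (r%:E <= a)%E]).
  have : nbhs alpha [set a | (r%:E < a)%E].
    by apply: open_nbhs_nbhs; split; first exact: open_ereal_gt_ereal.
  by apply: filterS => a; exact: ltW.
- exact: (hypo_cvg_supS N_norm (fhat^~ w) f0 fw _ cB BS aw).
Qed.
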